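(* Let $\delta$ be a matrix of free polynomials in $d$ variables, let $\psi_1,\dots,\psi_k\in H^\infty(G_\delta)$, and suppose that for some $\varepsilon>0$, $\sum_{j=1}^k\psi_j(x)^*\psi_j(x)\ge\varepsilon^2 I_{\mathbb C^n}$ for all $n$ and all $x\in G_\delta\cap\mathcal M_n^d$. Then there exist $\omega_1,\dots,\omega_k\in H^\infty(G_\delta)$ with $\sup_{x\in G_\delta}\|(\omega_1(x),\dots,\omega_k(x))\|\le 1/\varepsilon$ (the norm of the row operator $\mathbb C^n\otimes\mathbb C^k\to\mathbb C^n$) such that $\sum_{j=1}^k\omega_j(x)\psi_j(x)=I_{\mathbb C^n}$ for all $n$ and all $x\in G_\delta\cap\mathcal M_n^d$.
   Context: $\mathcal M^d=\bigcup_n\mathcal M_n^d$ ($d$-tuples of $n\times n$ complex matrices); $G_\delta=\{M\in\mathcal M^d:\|\delta(M)\|<1\}$. $H^\infty(G_\delta)$ is the set of bounded nc-functions on $G_\delta$: maps $\phi$ with $\phi(x)\in\mathcal M_n$ for $x\in G_\delta\cap\mathcal M_n^d$, $\phi(x\oplus y)=\phi(x)\oplus\phi(y)$, $\phi(s^{-1}xs)=s^{-1}\phi(x)s$ whenever $s$ is invertible and $x,s^{-1}xs\in G_\delta$, and $\sup_{x\in G_\delta}\|\phi(x)\|<\infty$. *)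

(* Defs.v *)
From HB Require Import structures.
From mathcomp Require Import all_boot all_order all_algebra.
From mathcomp Require Import complex.
From mathcomp Require Import boolp classical_sets reals.
Set Implicit Arguments. Unset Strict Implicit. Unset Printing Implicit Defensive.
Import Order.TTheory GRing.Theory Num.Theory.
Local Open Scope ring_scope.
Local Open Scope complex_scope.

Definition abs2 {R : realType} (z : R[i]) : R := complex.Re z ^+ 2 + complex.Im z ^+ 2.

(** squared Euclidean (Hilbert-Schmidt) norm of a matrix of complex numbers;
    a matrix V : 'M_(n, q) is read as the vector (V_{.,0}, ..., V_{.,q-1})
    of C^n (x) C^q = (C^n)^q *)
Definition fnorm2 {R : realType} m k (A : 'M[R[i]]_(m, k)) : R :=
  \sum_(a < m) \sum_(b < k) abs2 (A a b).

(** the block operator T = (T_ij) : (C^n)^q -> (C^n)^p, T_ij in M_n,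
    applied to V : 'M_(n,q) (column j = j-th component) *)
Definition blockapp {R : realType} n p q (T : 'I_p -> 'I_q -> 'M[R[i]]_n)
    (V : 'M[R[i]]_(n, q)) : 'M[R[i]]_(n, p) :=
  \matrix_(a < n, i < p) (\sum_(j < q) (T i j *m col j V)) a 0.

Definition bnorm {R : realType} n p q (T : 'I_p -> 'I_q -> 'M[R[i]]_n) : R :=
  sup [set Num.sqrt (fnorm2 (blockapp T V)) | V in
        [set V : 'M[R[i]]_(n, q) | fnorm2 V <= 1]]%classic.

Definition opnorm {R : realType} n (A : 'M[R[i]]_n) : R :=
  bnorm (fun (_ : 'I_1) (_ : 'I_1) => A).

(** Free (noncommutative) polynomials in d variables with complex coefficients,
    represented as finite sums of coefficient * word. *)
Definition ncpoly (R : realType) (d : nat) := seq (R[i] * seq 'I_d).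

Definition ncpoint (R : realType) (d n : nat) := 'I_d -> 'M[R[i]]_n.

Definition word_eval {R : realType} d n (x : ncpoint R d n) (w : seq 'I_d)
  : 'M[R[i]]_n := foldr (fun i acc => x i *m acc) 1%:M w.

Definition nceval {R : realType} d n (P : ncpoly R d) (x : ncpoint R d n)
  : 'M[R[i]]_n := \sum_(m <- P) m.1 *: word_eval x m.2.

Definition Gdelta {R : realType} d p q (delta : 'I_p -> 'I_q -> ncpoly R d)
    n (x : ncpoint R d n) : Prop :=
  bnorm (fun i j => nceval (delta i j) x) < 1.

(** A function on (the graded set) M^d, to be considered on G_delta. *)
Definition ncfun (R : realType) (d : nat) := forall n, ncpoint R d n -> 'M[R[i]]_n.

Definition dsum_pt {R : realType} d n m (x : ncpoint R d n) (y : ncpoint R d m)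
  : ncpoint R d (n + m) := fun i => block_mx (x i) 0 0 (y i).

Definition conj_pt {R : realType} d n (s : 'M[R[i]]_n) (x : ncpoint R d n)
  : ncpoint R d n := fun i => invmx s *m x i *m s.

Definition Hinf {R : realType} d p q (delta : 'I_p -> 'I_q -> ncpoly R d)
    (phi : ncfun R d) : Prop :=
  [/\ (forall n m (x : ncpoint R d n) (y : ncpoint R d m),
        Gdelta delta x -> Gdelta delta y ->
        phi (n + m)%N (dsum_pt x y) = block_mx (phi n x) 0 0 (phi m y)),
      (forall n (x : ncpoint R d n) (s : 'M[R[i]]_n),
        s \in unitmx -> Gdelta delta x -> Gdelta delta (conj_pt s x) ->
        phi n (conj_pt s x) = invmx s *m phi n x *m s) &
      (exists M : R, forall n (x : ncpoint R d n),
        Gdelta delta x -> opnorm (phi n x) <= M)].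

Definition adj {R : realType} m k (A : 'M[R[i]]_(m, k)) : 'M[R[i]]_(k, m) :=
  (map_mx (@conjc R) A)^T.

Definition geI {R : realType} n (A : 'M[R[i]]_n) (c : R) : Prop :=
  forall v : 'cV[R[i]]_n, c * fnorm2 v <= complex.Re ((adj v *m A *m v) 0 0).

(* Main.v *)
Require Import Defs.
From HB Require Import structures.
From mathcomp Require Import all_boot all_order all_algebra.
From mathcomp Require Import complex spectral sesquilinear.
From mathcomp Require Import boolp classical_sets reals.
From mathcomp Require Import filter topology normedtype.
From mathcomp Require Import ring lra.

(** Fix a point Lam of G_delta and a vector u.  The hermitian matrix
    sum_j psi_j(Lam) u u^* psi_j(Lam)^* - eps^2 u u^*  lies in the closure of the
    cone generated by the matrices  g g^* - (delta(Lam) g) (delta(Lam) g)^*  and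
    v v^*.  Indeed a separating functional is a positive definite matrix S^* S for
    which S Lam S^-1 lies again in G_delta, and the lower bound on
    sum_j psi_j^* psi_j at that point, applied to the vector S u, contradicts the
    separation.  A matrix of the cone close to the target yields, by Douglas'
    factorization, a contractive colligation V (the lurking isometry); its transfer
    function is a contractive nc row function T on all of G_delta with
    T(Lam) psi(Lam) u close to eps u.  Direct sums of points show that finitely many
    such conditions can be met simultaneously, and a limit along an ultrafilter on
    the set of nc rows meets all of them exactly; omega = T / eps. *)

Set Implicit Arguments. Unset Strict Implicit. Unset Printing Implicit Defensive.
Import Order.TTheory GRing.Theory Num.Theory.
Import numFieldNormedType.Exports.
Local Open Scope ring_scope.
Local Open Scope complex_scope.

(** * The real Hilbert-Schmidt inner product and factorization of positive definite matrices *)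

Section RealDot.
Variable R : realType.
Local Notation C := R[i].
Implicit Types m n k : nat.

(** Taking the real part gives a real inner product, which is what the convexity argument for the
    cone needs. *)
Definition rdot m n (A B : 'M[C]_(m, n)) : R := complex.Re (\tr (adj A *m B)).

Lemma ReD (x y : C) : complex.Re (x + y) = complex.Re x + complex.Re y.
Proof. by case: x; case: y. Qed.

Lemma ReN (x : C) : complex.Re (- x) = - complex.Re x.
Proof. by case: x. Qed.

Lemma Re_sum I (r : seq I) (P : pred I) (F : I -> C) :
  complex.Re (\sum_(i <- r | P i) F i) = \sum_(i <- r | P i) complex.Re (F i).
Proof. exact: (big_morph _ ReD). Qed.

Lemma ReZ (a : R) (x : C) : complex.Re (a%:C * x) = a * complex.Re x.
Proof. by case: x => b c /=; rewrite mul0r subr0. Qed.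

Lemma adjD m n (A B : 'M[C]_(m, n)) : adj (A + B) = adj A + adj B.
Proof. by rewrite /adj map_mxD linearD. Qed.

Lemma adjN m n (A : 'M[C]_(m, n)) : adj (- A) = - adj A.
Proof. by rewrite /adj map_mxN linearN. Qed.

Lemma adj0 m n : adj (0 : 'M[C]_(m, n)) = 0.
Proof. by rewrite /adj map_mx0 trmx0. Qed.

Lemma adj_scale m n (a : R) (A : 'M[C]_(m, n)) : adj (a%:C *: A) = a%:C *: adj A.
Proof. by apply/matrixP=> i j; rewrite !mxE rmorphM /= oppr0. Qed.

Lemma adjM m n k (A : 'M[C]_(m, n)) (B : 'M[C]_(n, k)) :
  adj (A *m B) = adj B *m adj A.
Proof. by rewrite /adj map_mxM trmx_mul. Qed.

Lemma adjK m n (A : 'M[C]_(m, n)) : adj (adj A) = A.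
Proof. by apply/matrixP=> i j; rewrite !mxE conjcK. Qed.

Lemma adj_mx1 n : adj (1%:M : 'M[C]_n) = 1%:M.
Proof. by rewrite /adj map_mx1 trmx1. Qed.

Lemma adj_sum m n I (r : seq I) (F : I -> 'M[C]_(m, n)) :
  adj (\sum_(i <- r) F i) = \sum_(i <- r) adj (F i).
Proof. exact: (big_morph _ (@adjD m n) (@adj0 m n)). Qed.

Lemma adj_row_mx m n k (A : 'M[C]_(m, n)) (B : 'M[C]_(m, k)) :
  adj (row_mx A B) = col_mx (adj A) (adj B).
Proof. by rewrite /adj map_row_mx tr_row_mx. Qed.

Lemma Re_conjc (x : C) : complex.Re x^*%C = complex.Re x.
Proof. by case: x. Qed.

Lemma mxtrace_adj n (A : 'M[C]_n) : \tr (adj A) = (\tr A)^*%C.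
Proof.
by rewrite /mxtrace rmorph_sum; apply: eq_bigr => i _; rewrite !mxE.
Qed.

Lemma rdotC m n (A B : 'M[C]_(m, n)) : rdot A B = rdot B A.
Proof. by rewrite /rdot -[adj A *m B]adjK mxtrace_adj Re_conjc adjM adjK. Qed.

Lemma rdotDr m n (A B D : 'M[C]_(m, n)) : rdot A (B + D) = rdot A B + rdot A D.
Proof. by rewrite /rdot mulmxDr linearD ReD. Qed.

Lemma rdotZr m n (a : R) (A B : 'M[C]_(m, n)) : rdot A (a%:C *: B) = a * rdot A B.
Proof. by rewrite /rdot -scalemxAr linearZ ReZ. Qed.

Lemma rdot0r m n (A : 'M[C]_(m, n)) : rdot A 0 = 0.
Proof. by rewrite /rdot mulmx0 linear0. Qed.

Lemma rdotNr m n (A B : 'M[C]_(m, n)) : rdot A (- B) = - rdot A B.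
Proof. by rewrite /rdot mulmxN linearN ReN. Qed.

Lemma rdotBr m n (A B D : 'M[C]_(m, n)) : rdot A (B - D) = rdot A B - rdot A D.
Proof. by rewrite rdotDr rdotNr. Qed.

Lemma rdot_sumr m n I (r : seq I) A (F : I -> 'M[C]_(m, n)) :
  rdot A (\sum_(i <- r) F i) = \sum_(i <- r) rdot A (F i).
Proof. exact: (big_morph _ (@rdotDr m n A) (rdot0r A)). Qed.

Lemma rdotDl m n (A B D : 'M[C]_(m, n)) : rdot (B + D) A = rdot B A + rdot D A.
Proof. by rewrite rdotC rdotDr !(rdotC A). Qed.

Lemma rdotBl m n (A B D : 'M[C]_(m, n)) : rdot (B - D) A = rdot B A - rdot D A.
Proof. by rewrite rdotC rdotBr !(rdotC A). Qed.

Lemma rdotZl m n (a : R) (A B : 'M[C]_(m, n)) : rdot (a%:C *: A) B = a * rdot A B.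
Proof. by rewrite rdotC rdotZr (rdotC A). Qed.

Lemma rdot_suml m n I (r : seq I) A (F : I -> 'M[C]_(m, n)) :
  rdot (\sum_(i <- r) F i) A = \sum_(i <- r) rdot (F i) A.
Proof. by rewrite rdotC rdot_sumr; apply: eq_bigr => i _; rewrite rdotC. Qed.

Lemma rdot_adj m n (A B : 'M[C]_(m, n)) : rdot (adj A) (adj B) = rdot A B.
Proof. by rewrite rdotC /rdot adjK mxtrace_mulC. Qed.

Lemma rdot_mull m n k (A : 'M[C]_(m, n)) (B : 'M[C]_(n, k)) D :
  rdot (A *m B) D = rdot B (adj A *m D).
Proof. by rewrite /rdot adjM mulmxA. Qed.

Lemma rdot_mulr m n k (A : 'M[C]_(m, n)) (B : 'M[C]_(n, k)) D :
  rdot (A *m B) D = rdot A (D *m adj B).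
Proof. by rewrite /rdot adjM -mulmxA mxtrace_mulC mulmxA. Qed.

Lemma fnorm2E m n (A : 'M[C]_(m, n)) : fnorm2 A = rdot A A.
Proof.
rewrite /rdot /mxtrace Re_sum /fnorm2 exchange_big; apply: eq_bigr => j _ /=.
rewrite !mxE Re_sum; apply: eq_bigr => i _; rewrite !mxE /abs2.
by case: (A i j) => a b /=; rewrite !expr2 mulNr opprK.
Qed.

Lemma abs2_ge0 (z : C) : 0 <= abs2 z.
Proof. by rewrite /abs2 addr_ge0 ?sqr_ge0. Qed.

Lemma fnorm2_ge0 m n (A : 'M[C]_(m, n)) : 0 <= fnorm2 A.
Proof. by do 2!(apply: sumr_ge0 => ? _); exact: abs2_ge0. Qed.

Lemma abs2_le_fnorm2 m n (A : 'M[C]_(m, n)) i j : abs2 (A i j) <= fnorm2 A.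
Proof.
rewrite /fnorm2 (bigD1 i) //= (bigD1 j) //= -addrA lerDl addr_ge0 //.
  by apply: sumr_ge0 => ? _; exact: abs2_ge0.
by do 2!(apply: sumr_ge0 => ? _); exact: abs2_ge0.
Qed.

Lemma abs2_eq0 (z : C) : abs2 z <= 0 -> z = 0.
Proof.
case: z => a b; rewrite /abs2 /= => h.
have a0 : a ^+ 2 = 0 by apply/eqP; rewrite eq_le sqr_ge0 andbT; have := sqr_ge0 b; lra.
have b0 : b ^+ 2 = 0 by apply/eqP; rewrite eq_le sqr_ge0 andbT; have := sqr_ge0 a; lra.
by move/eqP: a0; move/eqP: b0; rewrite !sqrf_eq0 => /eqP-> /eqP->.
Qed.

Lemma fnorm2_eq0 m n (A : 'M[C]_(m, n)) : fnorm2 A <= 0 -> A = 0.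
Proof.
move=> h; apply/matrixP=> i j; rewrite mxE; apply: abs2_eq0.
exact: le_trans (abs2_le_fnorm2 A i j) h.
Qed.

Lemma fnorm20 m n : fnorm2 (0 : 'M[C]_(m, n)) = 0.
Proof. by rewrite fnorm2E rdot0r. Qed.

Lemma fnorm2Z m n (a : R) (A : 'M[C]_(m, n)) : fnorm2 (a%:C *: A) = a ^+ 2 * fnorm2 A.
Proof. by rewrite !fnorm2E rdotZr rdotZl mulrA expr2. Qed.

Lemma fnorm2N m n (A : 'M[C]_(m, n)) : fnorm2 (- A) = fnorm2 A.
Proof. by rewrite !fnorm2E rdotNr rdotC rdotNr opprK. Qed.

Lemma fnorm2D m n (A B : 'M[C]_(m, n)) :
  fnorm2 (A + B) = fnorm2 A + 2 * rdot A B + fnorm2 B.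
Proof. by rewrite !fnorm2E rdotDr !rdotDl (rdotC B A); ring. Qed.

Lemma fnorm2_adj m n (A : 'M[C]_(m, n)) : fnorm2 (adj A) = fnorm2 A.
Proof. by rewrite !fnorm2E rdot_adj. Qed.

Lemma fnorm2_row_mx m n k (A : 'M[C]_(m, n)) (B : 'M[C]_(m, k)) :
  fnorm2 (row_mx A B) = fnorm2 A + fnorm2 B.
Proof.
rewrite /fnorm2 -big_split; apply: eq_bigr => i _ /=; rewrite big_split_ord /=.
by congr (_ + _); apply: eq_bigr => j _; rewrite ?row_mxEl ?row_mxEr.
Qed.

Lemma fnorm2_col_mx m n k (A : 'M[C]_(m, k)) (B : 'M[C]_(n, k)) :
  fnorm2 (col_mx A B) = fnorm2 A + fnorm2 B.
Proof.
rewrite /fnorm2 big_split_ord /=.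
by congr (_ + _); do 2!(apply: eq_bigr => ? _); rewrite ?col_mxEu ?col_mxEd.
Qed.

Lemma rdot_CS m n (A B : 'M[C]_(m, n)) : rdot A B ^+ 2 <= fnorm2 A * fnorm2 B.
Proof.
have [B0|B0] := lerP (fnorm2 B) 0.
  by rewrite (fnorm2_eq0 B0) rdot0r fnorm20 mulr0 expr0n.
(* The norm of [|B|^2 A - <A, B> B], expanded, is [|B|^2] times the difference of the two sides. *)
have := fnorm2_ge0 ((fnorm2 B)%:C *: A + (- rdot A B)%:C *: B).
rewrite fnorm2D !fnorm2Z rdotZl rdotZr => h.
suff: 0 <= fnorm2 B * (fnorm2 A * fnorm2 B - rdot A B ^+ 2).
  by rewrite pmulr_rge0 // subr_ge0.
by apply: le_trans h _; rewrite le_eqVlt; apply/orP; left; apply/eqP; ring.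
Qed.

Lemma rdot_le_of_fnorm2 m n (A B : 'M[C]_(m, n)) (a b : R) : 0 <= a -> 0 <= b ->
  fnorm2 A <= a ^+ 2 -> fnorm2 B <= b ^+ 2 -> `|rdot A B| <= a * b.
Proof.
move=> a0 b0 hA hB; rewrite -(@ler_pXn2r _ 2%N) ?nnegrE ?normr_ge0 ?mulr_ge0 //.
rewrite real_normK ?num_real // exprMn; apply: le_trans (rdot_CS _ _) _.
by apply: ler_pM => //; exact: fnorm2_ge0.
Qed.

Lemma abs2M (z w : C) : abs2 (z * w) = abs2 z * abs2 w.
Proof. by case: z; case: w => a b c e; rewrite /abs2 /=; ring. Qed.

Lemma fnorm2Zc m n (c : C) (A : 'M[C]_(m, n)) : fnorm2 (c *: A) = abs2 c * fnorm2 A.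
Proof.
rewrite /fnorm2 mulr_sumr; apply: eq_bigr => i _; rewrite mulr_sumr.
by apply: eq_bigr => j _; rewrite mxE abs2M.
Qed.

(** [rdot_CS] bounds only a real part. Pairing [b] with [adj a *m z], for [z] the product itself,
    aligns the phase: the pairing equals [fnorm2 z]. *)
Lemma fnorm2_mul_le_scalar n (a : 'rV[C]_n) (b : 'cV[C]_n) :
  fnorm2 (a *m b) <= fnorm2 a * fnorm2 b.
Proof.
set z := a *m b; have [z0|z0] := lerP (fnorm2 z) 0.
  by apply: le_trans z0 _; rewrite mulr_ge0 ?fnorm2_ge0.
have zE : z = (z 0 0)%:M by apply: mx11_scalar.
have E : fnorm2 z = rdot b (adj a *m z) by rewrite fnorm2E {1}/z rdot_mull.
have Ez : fnorm2 (adj a *m z) = fnorm2 a * fnorm2 z.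
  rewrite zE mul_mx_scalar fnorm2Zc fnorm2_adj mulrC.
  by rewrite /fnorm2 !big_ord1 !mxE eqxx mulr1n.
have := rdot_CS b (adj a *m z); rewrite -E Ez => h.
rewrite -(@ler_pM2r _ (fnorm2 z)) // -expr2; apply: le_trans h _.
by rewrite mulrA (mulrC (fnorm2 b)).
Qed.

Lemma fnorm2_rows m n (A : 'M[C]_(m, n)) : fnorm2 A = \sum_i fnorm2 (row i A).
Proof.
apply: eq_bigr => i _; rewrite /fnorm2 big_ord1.
by apply: eq_bigr => j _; rewrite mxE.
Qed.

Lemma fnorm2_cols m n (A : 'M[C]_(m, n)) : fnorm2 A = \sum_j fnorm2 (col j A).
Proof.
rewrite /fnorm2 exchange_big; apply: eq_bigr => j _.
by apply: eq_bigr => i _; rewrite big_ord1 mxE.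
Qed.

Lemma fnorm2_delta m n i j : fnorm2 (delta_mx i j : 'M[C]_(m, n)) = 1.
Proof.
rewrite /fnorm2 (bigD1 i) //= (bigD1 j) //= !mxE !eqxx.
rewrite !big1 => [|i' ii|j' jj]; rewrite ?addr0.
- by rewrite /abs2 /= expr1n expr0n addr0.
- by apply: big1 => j' _; rewrite !mxE (negPf ii) /abs2 /= expr0n addr0.
- by rewrite !mxE (negPf jj) andbF /abs2 /= expr0n addr0.
Qed.

Lemma fnorm2M_le m n k (A : 'M[C]_(m, n)) (B : 'M[C]_(n, k)) :
  fnorm2 (A *m B) <= fnorm2 A * fnorm2 B.
Proof.
rewrite [X in X * _]fnorm2_rows [X in _ * X]fnorm2_cols [X in X <= _]fnorm2_rows.
rewrite mulr_suml; apply: ler_sum => i _.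
rewrite fnorm2_cols mulr_sumr; apply: ler_sum => j _.
by rewrite row_mul [col j (_ *m _)]colE -mulmxA -colE; apply: fnorm2_mul_le_scalar.
Qed.

Lemma fnorm2_mxvec m n (A : 'M[C]_(m, n)) : fnorm2 (mxvec A) = fnorm2 A.
Proof.
rewrite /fnorm2 big_ord1 pair_bigA /= (reindex _ (curry_mxvec_bij _ _)) /=.
by apply: eq_bigr => -[i j] _; rewrite mxvecE.
Qed.

(** The constant is the squared Hilbert-Schmidt norm of the matrix of [f] in vectorized
    coordinates. *)
Lemma linear_bounded m n k l (f : {linear 'M[C]_(m, n) -> 'M[C]_(k, l)}) :
  exists2 K : R, 0 <= K & forall V, fnorm2 (f V) <= K * fnorm2 V.
Proof.
exists (fnorm2 (lin_mx f)) => [|V]; first exact: fnorm2_ge0.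
by rewrite -fnorm2_mxvec -mul_vec_lin mulrC -(fnorm2_mxvec V); exact: fnorm2M_le.
Qed.

Definition selfadj n (P : 'M[C]_n) := adj P = P.

Lemma selfadjD n (P Q : 'M[C]_n) :
  selfadj P -> selfadj Q -> selfadj (P + Q).
Proof. by move=> hP hQ; rewrite /selfadj adjD hP hQ. Qed.

Lemma selfadj_sum n I (r : seq I) (F : I -> 'M[C]_n) :
  (forall i, selfadj (F i)) -> selfadj (\sum_(i <- r) F i).
Proof. by move=> h; rewrite /selfadj adj_sum; apply: eq_bigr => i _; exact: h. Qed.

Lemma selfadjB n (P Q : 'M[C]_n) :
  selfadj P -> selfadj Q -> selfadj (P - Q).
Proof. by move=> hP hQ; rewrite /selfadj adjD adjN hP hQ. Qed.

Lemma selfadjZ n (a : R) (P : 'M[C]_n) : selfadj P -> selfadj (a%:C *: P).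
Proof. by move=> hP; rewrite /selfadj adj_scale hP. Qed.

Lemma selfadj_mul_adj m n (A : 'M[C]_(m, n)) : selfadj (A *m adj A).
Proof. by rewrite /selfadj adjM adjK. Qed.

(** Diagonalize [P] by a unitary [Q] and take for [S] the square root of the diagonal part times
    [Q]. The value of [rdot P] at [v *m adj v] is the quadratic form of [P]. *)
Lemma posdef_factor n (P : 'M[C]_n) (t : R) : selfadj P -> 0 < t ->
  (forall v : 'cV[C]_n, t * fnorm2 v <= rdot P (v *m adj v)) ->
  exists2 S : 'M[C]_n, S \in unitmx & adj S *m S = P.
Proof.
move=> hP t0 posP.
have adjE m k (A : 'M[C]_(m, k)) : (A ^t* = adj A)%sesqui.
  by apply/matrixP=> i j; rewrite !mxE.
have /orthomx_spectralP PE : P \is normalmx.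
  by apply/normalmxP; rewrite adjE hP.
have hu := spectral_unitarymx P.
set Q := spectralmx P in PE hu; set D := spectral_diag P in PE.
have QQ : Q *m adj Q = 1%:M by rewrite -adjE; apply/unitarymxP.
have QQ' : adj Q *m Q = 1%:M by apply: mulmx1C.
rewrite invmx_unitary // adjE in PE.
have DE : diag_mx D = Q *m P *m adj Q.
  by rewrite PE !mulmxA QQ mul1mx -mulmxA QQ mulmx1.
have Dpos i : D 0 i = (complex.Re (D 0 i))%:C /\ t <= complex.Re (D 0 i).
  have Dr : D 0 i = (complex.Re (D 0 i))%:C.
    have : selfadj (diag_mx D) by rewrite /selfadj DE !adjM adjK hP mulmxA.
    move/matrixP=> /(_ i i); rewrite !mxE eqxx !mulr1n.
    by case: (D 0 i) => a b [] ?; congr (_ +i* _); lra.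
  split=> //.
  (* Testing the lower bound on the [i]-th eigenvector bounds the eigenvalue from below by [t]. *)
  have := posP (adj Q *m delta_mx i 0).
  set e := delta_mx i 0.
  have -> : rdot P (adj Q *m e *m adj (adj Q *m e)) = rdot e (diag_mx D *m e).
    rewrite adjM adjK mulmxA rdotC rdot_mulr -[adj Q *m e *m _]mulmxA rdot_mull.
    by rewrite adjK mulmxA -DE rdot_mulr adjK.
  have -> : diag_mx D *m e = (complex.Re (D 0 i))%:C *: e.
    apply/matrixP=> a b; rewrite mul_diag_mx !mxE -Dr.
    by case: eqVneq => [->|_] //=; rewrite !mulr0.
  rewrite rdotZr fnorm2E rdot_mull adjK mulmxA QQ mul1mx -fnorm2E.
  by rewrite fnorm2_delta !mulr1.
pose S := diag_mx (map_mx (fun z => (Num.sqrt (complex.Re z))%:C) D) *m Q.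
have SS : adj S *m S = P.
  rewrite /S adjM -mulmxA [_ *m (_ *m Q)]mulmxA PE mulmxA; congr (_ *m _ *m _).
  rewrite /adj map_diag_mx tr_diag_mx mulmx_diag; congr diag_mx.
  apply/rowP=> i; rewrite !mxE; have [e le_t] := Dpos i.
  have r0 : 0 <= complex.Re (D 0 i) by apply: le_trans le_t; exact: ltW.
  rewrite [RHS]e; apply/eqP; rewrite eq_complex /= oppr0 !mul0r mulr0 subr0 addr0.
  by rewrite -expr2 sqr_sqrtr // !eqxx.
exists S => //.
rewrite unitmx_mul spectral_unit andbT unitmxE det_diag unitfE.
apply/prodf_neq0 => i _; rewrite !mxE; have [_ le_t] := Dpos i.
by rewrite (inj_eq (@complexI R) _ 0) sqrtr_eq0 -ltNge; apply: lt_le_trans le_t.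
Qed.
End RealDot.

(** * Block operators: operator norm, amplification, fixed points of strict contractions *)

Section BlockOperators.
Variable R : realType.
Local Notation C := R[i].

Lemma col_blockapp n p q (T : 'I_p -> 'I_q -> 'M[C]_n) V i :
  col i (blockapp T V) = \sum_j T i j *m col j V.
Proof. by apply/colP=> a; rewrite !mxE. Qed.

Lemma matrix_eq_cols n p (A B : 'M[C]_(n, p)) : (forall i, col i A = col i B) -> A = B.
Proof. by move=> h; apply/matrixP=> a i; have /colP/(_ a) := h i; rewrite !mxE. Qed.

Lemma blockapp_is_linear n p q (T : 'I_p -> 'I_q -> 'M[C]_n) : linear (blockapp T).
Proof.
move=> a U V; apply: matrix_eq_cols => i; rewrite linearP /= !col_blockapp.
rewrite scaler_sumr -big_split; apply: eq_bigr => j _ /=.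
by rewrite linearP /= linearP.
Qed.

HB.instance Definition _ n p q (T : 'I_p -> 'I_q -> 'M[C]_n) :=
  GRing.isLinear.Build C 'M[C]_(n, q) 'M[C]_(n, p) _ (blockapp T)
    (blockapp_is_linear T).

Lemma blockapp_intertwine m n p q (T : 'I_p -> 'I_q -> 'M[C]_n)
    (T' : 'I_p -> 'I_q -> 'M[C]_m) (S : 'M[C]_(m, n)) V :
  (forall i j, T' i j *m S = S *m T i j) ->
  blockapp T' (S *m V) = S *m blockapp T V.
Proof.
move=> h; apply: matrix_eq_cols => i; rewrite [RHS]colE -mulmxA -colE.
rewrite !col_blockapp mulmx_sumr; apply: eq_bigr => j _.
by rewrite !colE !mulmxA h.
Qed.

Lemma bnorm_le n p q (T : 'I_p -> 'I_q -> 'M[C]_n) (c : R) : 0 <= c ->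
  (forall V, fnorm2 (blockapp T V) <= c ^+ 2 * fnorm2 V) -> bnorm T <= c.
Proof.
move=> c0 h; apply: ge_sup.
  by exists (Num.sqrt (fnorm2 (blockapp T 0))), 0 => //=; rewrite fnorm20.
move=> _ [V /= hV <-]; rewrite -[leRHS](@ger0_norm _ c) // -sqrtr_sqr ler_wsqrtr //.
by apply: le_trans (h V) _; rewrite -[leRHS]mulr1 ler_wpM2l ?sqr_ge0.
Qed.

Lemma has_ubound_bnorm n p q (T : 'I_p -> 'I_q -> 'M[C]_n) :
  has_ubound [set Num.sqrt (fnorm2 (blockapp T V)) | V in
        [set V : 'M[C]_(n, q) | fnorm2 V <= 1]]%classic.
Proof.
have [K K0 hK] := linear_bounded (blockapp T).
exists (Num.sqrt K) => _ [V /= hV <-]; rewrite ler_wsqrtr //.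
by apply: le_trans (hK V) _; rewrite -[leRHS]mulr1 ler_wpM2l.
Qed.

Lemma bnorm_ge0 n p q (T : 'I_p -> 'I_q -> 'M[C]_n) : 0 <= bnorm T.
Proof.
apply: le_trans (sqrtr_ge0 (fnorm2 (blockapp T 0))) _.
by apply: ub_le_sup; [exact: has_ubound_bnorm | exists 0 => //=; rewrite fnorm20].
Qed.

Lemma fnorm2_blockapp_le n p q (T : 'I_p -> 'I_q -> 'M[C]_n) V :
  fnorm2 (blockapp T V) <= bnorm T ^+ 2 * fnorm2 V.
Proof.
have [V0|V0] := lerP (fnorm2 V) 0.
  by rewrite (fnorm2_eq0 V0) linear0 !fnorm20 mulr0.
pose t := Num.sqrt (fnorm2 V); have t0 : 0 < t by rewrite sqrtr_gt0.
have tE : t ^+ 2 = fnorm2 V by rewrite sqr_sqrtr // ltW.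
have : Num.sqrt (fnorm2 (blockapp T (t^-1%:C *: V))) <= bnorm T.
  apply: ub_le_sup; first exact: has_ubound_bnorm.
  exists (t^-1%:C *: V) => //=.
  by rewrite fnorm2Z -tE -exprMn mulVf ?gt_eqF // expr1n.
move=> h; have := h; rewrite -(@ler_pXn2r _ 2%N) ?nnegrE ?sqrtr_ge0 ?bnorm_ge0 //.
rewrite sqr_sqrtr ?fnorm2_ge0 // linearZ /= fnorm2Z exprVn tE.
by rewrite ler_pdivrMl // mulrC.
Qed.

(** The constant [r] bounds squared norms. Arbitrary maps are allowed so that conjugates of a block
    operator by a similarity are covered. *)
Definition strict_contraction n p q (f : 'M[C]_(n, q) -> 'M[C]_(n, p)) :=
  exists2 r : R, 0 <= r < 1 & forall V, fnorm2 (f V) <= r * fnorm2 V.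

Lemma bnorm_lt1P n p q (T : 'I_p -> 'I_q -> 'M[C]_n) :
  bnorm T < 1 <-> strict_contraction (blockapp T).
Proof.
split=> [h|[r /andP[r0 r1] h]].
  exists (bnorm T ^+ 2); last exact: fnorm2_blockapp_le.
  by rewrite sqr_ge0 expr_lt1 ?bnorm_ge0.
apply: (@le_lt_trans _ _ (Num.sqrt r)).
  by apply: bnorm_le => [|V]; rewrite ?sqrtr_ge0 ?sqr_sqrtr.
by rewrite -sqrtr1 ltr_sqrt.
Qed.

(** The operator [f] tensored with the identity of [C^l]: it acts on [l] consecutive groups of
    columns. The recursion relies on [l.+1 * q] being convertible to [q + l * q]. *)
Fixpoint ampl n p q (f : 'M[C]_(n, q) -> 'M[C]_(n, p)) (l : nat) :
    'M[C]_(n, l * q) -> 'M[C]_(n, l * p) :=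
  match l with
  | 0 => fun _ => 0
  | l'.+1 => fun X : 'M_(n, q + l' * q) =>
      row_mx (f (lsubmx X)) (ampl f (rsubmx X)) : 'M_(n, p + l' * p)
  end.

Lemma ampl_is_linear n p q (f : {linear 'M[C]_(n, q) -> 'M[C]_(n, p)}) l :
  linear (@ampl n p q f l).
Proof.
elim: l => [|l IH] a X Y /=; first by rewrite scaler0 addr0.
rewrite (linearP (@lsubmx C n q (l * q))) (linearP (@rsubmx C n q (l * q))) /=.
by rewrite linearP IH scale_row_mx add_row_mx.
Qed.

HB.instance Definition _ n p q (f : {linear 'M[C]_(n, q) -> 'M[C]_(n, p)}) l :=
  GRing.isLinear.Build C _ _ _ (@ampl n p q f l) (@ampl_is_linear n p q f l).

Lemma fnorm2_ampl_le n p q (f : 'M[C]_(n, q) -> 'M[C]_(n, p)) (r : R) l X :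
  0 <= r -> (forall V, fnorm2 (f V) <= r * fnorm2 V) ->
  fnorm2 (@ampl n p q f l X) <= r * fnorm2 X.
Proof.
move=> r0 hf; elim: l X => [|l IH] X /=; first by rewrite fnorm20 mulr_ge0 ?fnorm2_ge0.
rewrite -[X in leRHS](@hsubmxK _ _ q (l * q)) !fnorm2_row_mx mulrDr.
by apply: lerD; rewrite ?hf ?IH.
Qed.

Lemma ampl_intertwine m n p q (f : 'M[C]_(n, q) -> 'M[C]_(n, p))
    (g : 'M[C]_(m, q) -> 'M[C]_(m, p)) (S : 'M[C]_(m, n)) l (X : 'M[C]_(n, l * q)) :
  (forall V, g (S *m V) = S *m f V) -> ampl g (S *m X) = S *m ampl f X.
Proof.
move=> h; elim: l X => [|l IH] X /=; first by rewrite mulmx0.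
by rewrite mul_mx_row -h -IH -mulmx_lsub -mulmx_rsub.
Qed.

Fixpoint row_of_seq n q (gs : seq 'M[C]_(n, q)) : 'M[C]_(n, size gs * q) :=
  match gs with
  | [::] => 0
  | g :: gs' => row_mx g (row_of_seq gs') : 'M_(n, q + size gs' * q)
  end.

(** Amounts to [G *m adj G] being the sum of the [g *m adj g], put through quadratic forms as
    [douglas] will need it. *)
Lemma row_of_seq_adj n q k (gs : seq 'M[C]_(n, q)) (X : 'M[C]_(n, k)) :
  fnorm2 (adj (row_of_seq gs) *m X) = \sum_(g <- gs) fnorm2 (adj g *m X).
Proof.
elim: gs => [|g gs IH] /=; first by rewrite big_nil adj0 mul0mx fnorm20.
by rewrite big_cons adj_row_mx mul_col_mx fnorm2_col_mx IH.
Qed.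

Lemma ampl_row_of_seq_adj n p q k (f : 'M[C]_(n, q) -> 'M[C]_(n, p))
    (gs : seq 'M[C]_(n, q)) (X : 'M[C]_(n, k)) :
  fnorm2 (adj (ampl f (row_of_seq gs)) *m X) = \sum_(g <- gs) fnorm2 (adj (f g) *m X).
Proof.
elim: gs => [|g gs IH] /=; first by rewrite big_nil adj0 mul0mx fnorm20.
by rewrite big_cons row_mxKl row_mxKr adj_row_mx mul_col_mx fnorm2_col_mx IH.
Qed.

(** The map [X - f X] is injective, since [X = f X] forces [fnorm2 X <= r * fnorm2 X]; in finite
    dimension it is then invertible. *)
Lemma strict_contraction_fix m n (f : {linear 'M[C]_(m, n) -> 'M[C]_(m, n)}) (r : R) Y :
  r < 1 -> (forall V, fnorm2 (f V) <= r * fnorm2 V) -> exists X, X = Y + f X.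
Proof.
move=> r1 hf; pose g := fun X => X - f X.
have gl : linear g by move=> a U V; rewrite /g linearP scalerBr opprD addrACA.
pose gL := HB.pack_for {linear 'M[C]_(m, n) -> 'M[C]_(m, n)} g
  (GRing.isLinear.Build C _ _ _ g gl).
have inj X : g X = 0 -> X = 0.
  move/eqP; rewrite subr_eq0 => /eqP e; apply: fnorm2_eq0.
  by have := hf X; rewrite -e; have := fnorm2_ge0 X; nra.
have u : lin_mx gL \in unitmx.
  rewrite -row_free_unit -kermx_eq0; apply/eqP/row_matrixP=> i; rewrite row0.
  set v := row i _; have v0 : v *m lin_mx gL = 0 by rewrite -row_mul mulmx_ker row0.
  rewrite -[v]vec_mxK [vec_mx v]inj ?linear0 //.
  by apply: (can_inj mxvecK); rewrite -(mul_vec_lin gL) vec_mxK v0 linear0.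
exists (vec_mx (mxvec Y *m invmx (lin_mx gL))); set X := vec_mx _.
have : gL X = Y.
  by apply: (can_inj mxvecK); rewrite -mul_vec_lin vec_mxK mulmxKV.
by move=> /= <-; rewrite /g subrK.
Qed.

End BlockOperators.

(** * Contractive colligations and their transfer functions *)

Section Transfer.
Variables (R : realType) (d p q : nat) (delta : 'I_p -> 'I_q -> ncpoly R d).
Local Notation C := R[i].
Local Notation Dl x := (blockapp (fun i j => nceval (delta i j) x)).
Implicit Types m n l K : nat.

Lemma word_eval_intertwine m n (y : ncpoint R d m) (x : ncpoint R d n)
    (S : 'M[C]_(m, n)) w :
  (forall i, y i *m S = S *m x i) -> word_eval y w *m S = S *m word_eval x w.
Proof.
move=> h; elim: w => [|i w IH] /=; first by rewrite mul1mx mulmx1.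
by rewrite -mulmxA IH !mulmxA h.
Qed.

Lemma nceval_intertwine m n (y : ncpoint R d m) (x : ncpoint R d n)
    (S : 'M[C]_(m, n)) (P : ncpoly R d) :
  (forall i, y i *m S = S *m x i) -> nceval P y *m S = S *m nceval P x.
Proof.
move=> h; rewrite /nceval mulmx_suml mulmx_sumr; apply: eq_bigr => w _.
by rewrite -scalemxAl -scalemxAr (word_eval_intertwine _ h).
Qed.

Lemma delta_intertwine m n (y : ncpoint R d m) (x : ncpoint R d n)
    (S : 'M[C]_(m, n)) V :
  (forall i, y i *m S = S *m x i) -> Dl y (S *m V) = S *m Dl x V.
Proof. by move=> h; apply: blockapp_intertwine => i j; apply: nceval_intertwine. Qed.

(** The inclusions of the summands intertwine each point with the direct sum, which turns direct
    sums into a case of intertwining. *)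
Lemma dsum_pt_inl m n (x : ncpoint R d m) (y : ncpoint R d n) i :
  dsum_pt x y i *m col_mx 1%:M 0 = col_mx 1%:M 0 *m x i.
Proof. by rewrite mul_block_col mul_col_mx !mul0mx !mulmx0 mulmx1 mul1mx !addr0. Qed.

Lemma dsum_pt_inr m n (x : ncpoint R d m) (y : ncpoint R d n) i :
  dsum_pt x y i *m col_mx 0 1%:M = col_mx 0 1%:M *m y i.
Proof. by rewrite mul_block_col mul_col_mx !mul0mx !mulmx0 mulmx1 mul1mx !add0r. Qed.

Lemma mul_inl_mx m n k (Z : 'M[C]_(m, k)) :
  (col_mx 1%:M 0 : 'M_(m + n, m)) *m Z = col_mx Z 0.
Proof. by rewrite mul_col_mx mul1mx mul0mx. Qed.

Lemma mul_inr_mx m n k (Z : 'M[C]_(n, k)) :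
  (col_mx 0 1%:M : 'M_(m + n, n)) *m Z = col_mx 0 Z.
Proof. by rewrite mul_col_mx mul1mx mul0mx. Qed.

(** Through the two inclusions [delta] acts on each summand separately, so the larger of the two
    contraction constants serves. *)
Lemma Gdelta_dsum m n (x : ncpoint R d m) (y : ncpoint R d n) :
  Gdelta delta x -> Gdelta delta y -> Gdelta delta (dsum_pt x y).
Proof.
move=> /bnorm_lt1P[r /andP[r0 r1] hr] /bnorm_lt1P[s /andP[s0 s1] hs].
apply/bnorm_lt1P; exists (Num.max r s); first by rewrite le_max r0 gt_max r1 s1.
move=> V; rewrite -[V]vsubmxK.
have -> : col_mx (usubmx V) (dsubmx V) =
    col_mx 1%:M 0 *m usubmx V + col_mx 0 1%:M *m dsubmx V.
  by rewrite mul_inl_mx mul_inr_mx add_col_mx addr0 add0r.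
rewrite linearD /= (delta_intertwine _ (dsum_pt_inl x y)).
rewrite (delta_intertwine _ (dsum_pt_inr x y)) !mul_inl_mx !mul_inr_mx.
rewrite !add_col_mx !addr0 !add0r !fnorm2_col_mx mulrDr.
apply: lerD; [apply: le_trans (hr _) _ | apply: le_trans (hs _) _].
  by apply: ler_wpM2r; rewrite ?fnorm2_ge0 // le_max lexx.
by apply: ler_wpM2r; rewrite ?fnorm2_ge0 // le_max lexx orbT.
Qed.

Definition ncrow K := forall n, ncpoint R d n -> 'M[C]_(n, K) -> 'cV[C]_n.

(** A contractive row of [K] nc functions, seen as an operator on [K]-tuples of vectors.
    Intertwining by rectangular [S] encodes both nc axioms: inclusions give direct sums, invertible
    [S] gives similarities. *)
Definition schur_row K (T : ncrow K) : Prop :=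
  [/\ forall n (x : ncpoint R d n) (a : C) Z Z', Gdelta delta x ->
        T n x (a *: Z + Z') = a *: T n x Z + T n x Z',
      forall n (x : ncpoint R d n) Z, Gdelta delta x ->
        fnorm2 (T n x Z) <= fnorm2 Z &
      forall m n (y : ncpoint R d m) (x : ncpoint R d n) (S : 'M[C]_(m, n)) Z,
        Gdelta delta y -> Gdelta delta x -> (forall i, y i *m S = S *m x i) ->
        T m y (S *m Z) = S *m T n x Z].

(** Tuples of vectors are matrices with the components as columns, so scalar block matrices act on
    the right; [n] is arbitrary because a colligation is used at points of every size. *)
Definition right_contraction a b (V : 'M[C]_(a, b)) :=
  forall n (Z : 'M[C]_(n, a)), fnorm2 (Z *m V) <= fnorm2 Z.

Section Colligation.
Variables (K l : nat) (V : 'M[C]_(K + l * p, 1 + l * q)).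
Hypothesis hV : right_contraction V.

(* [w] is the output and [X] the internal state of the linear system with
   colligation [V], feedback [delta x] and input [Z]. *)
Definition system n (x : ncpoint R d n) (Z : 'M[C]_(n, K)) (w : 'cV[C]_n)
    (X : 'M[C]_(n, l * q)) :=
  row_mx w X = row_mx Z (ampl (Dl x) X) *m V.

Lemma system_linear n (x : ncpoint R d n) a Z Z' w w' X X' :
  system x Z w X -> system x Z' w' X' ->
  system x (a *: Z + Z') (a *: w + w') (a *: X + X').
Proof.
rewrite /system => h h'; rewrite linearP /= -!add_row_mx -!scale_row_mx h h'.
by rewrite mulmxDl scalemxAl.
Qed.

(** Energy balance: [|w|^2 + |X|^2 <= |Z|^2 + |delta(x) X|^2 <= |Z|^2 + r |X|^2] with [r < 1]. *)
Lemma system_bound n (x : ncpoint R d n) Z w X :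
  Gdelta delta x -> system x Z w X -> fnorm2 w <= fnorm2 Z.
Proof.
move=> /bnorm_lt1P[r /andP[r0 r1] hr] h.
have := hV (row_mx Z (ampl (Dl x) X)); rewrite -h !fnorm2_row_mx.
have := @fnorm2_ampl_le R n p q (Dl x) r l X r0 hr.
by have := fnorm2_ge0 X; nra.
Qed.

(** The difference of two solutions has input 0, hence output 0 by [system_bound]. *)
Lemma system_unique n (x : ncpoint R d n) Z w w' X X' :
  Gdelta delta x -> system x Z w X -> system x Z w' X' -> w = w'.
Proof.
move=> hx h h'; have := system_linear (-1) h' h; rewrite !scaleN1r addNr.
move/(system_bound hx); rewrite fnorm20 => /fnorm2_eq0/eqP.
by rewrite addrC subr_eq0 => /eqP.
Qed.

(** The state solves a fixed point equation for a strict contraction; the output is then read off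
    from the first block column of [V]. *)
Lemma system_exists n (x : ncpoint R d n) Z :
  Gdelta delta x -> exists w X, system x Z w X.
Proof.
move=> /bnorm_lt1P[r /andP[r0 r1] hr].
pose f := (mulmxr (drsubmx V) \o @ampl R n p q (Dl x) l)%FUN.
have hf X : fnorm2 (f X) <= r * fnorm2 X.
  apply: le_trans (@fnorm2_ampl_le R n p q (Dl x) r l X r0 hr).
  (* Feeding a zero input shows that the lower right block of [V] is itself a contraction. *)
  have := hV (row_mx 0 (ampl (Dl x) X)); rewrite -[V]submxK mul_row_block !mul0mx !add0r.
  rewrite !fnorm2_row_mx fnorm20 add0r; apply: le_trans.
  by rewrite /f /= lerDr fnorm2_ge0.
have [X hX] := strict_contraction_fix (Z *m ursubmx V) r1 hf.
exists (Z *m ulsubmx V + ampl (Dl x) X *m dlsubmx V), X.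
by rewrite /system -[V in RHS]submxK mul_row_block; congr row_mx.
Qed.

(** [S] multiplies on the left and [V] on the right, so the two do not interfere. *)
Lemma system_intertwine m n (y : ncpoint R d m) (x : ncpoint R d n)
    (S : 'M[C]_(m, n)) Z w X :
  (forall i, y i *m S = S *m x i) -> system x Z w X ->
  system y (S *m Z) (S *m w) (S *m X).
Proof.
rewrite /system => hS h; rewrite -mul_mx_row h.
rewrite (@ampl_intertwine _ _ _ _ _ (Dl x) (Dl y) S) => [|U].
  by rewrite -mul_mx_row mulmxA.
exact: delta_intertwine.
Qed.

Lemma transfer : exists2 T : ncrow K, schur_row T &
  forall n (x : ncpoint R d n) Z w X, Gdelta delta x -> system x Z w X -> T n x Z = w.
Proof.
(* With membership inside the existential, [T] is total; outside [Gdelta] its value is arbitrary. *)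
have ex n (x : ncpoint R d n) Z : exists w, Gdelta delta x -> exists X, system x Z w X.
  have [hx|nhx] := pselect (Gdelta delta x); last by exists 0.
  by have [w [X h]] := system_exists Z hx; exists w => _; exists X.
pose T : ncrow K := fun n x Z => sval (cid (ex n x Z)).
have TP n (x : ncpoint R d n) Z : Gdelta delta x -> exists X, system x Z (T n x Z) X.
  exact: (svalP (cid (ex n x Z))).
have TE n (x : ncpoint R d n) Z w X : Gdelta delta x -> system x Z w X -> T n x Z = w.
  by move=> hx h; have [X' h'] := TP n x Z hx; exact: system_unique hx h' h.
exists T => //; split.
- move=> n x a Z Z' hx; have [X h] := TP n x Z hx; have [X' h'] := TP n x Z' hx.
  exact: TE hx (system_linear a h h').
- by move=> n x Z hx; have [X h] := TP n x Z hx; exact: system_bound hx h.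
- move=> m n y x S Z hy hx hS; have [X h] := TP n x Z hx.
  exact: TE hy (system_intertwine hS h).
Qed.

End Colligation.
End Transfer.

(** * Duality: approximating the target matrix from the cone *)

Section ConeApproximation.
Variable R : realType.
Local Notation C := R[i].

Section NearMinimizer.
Variables (N : nat) (cone : 'M[C]_N -> Prop) (Th h : 'M[C]_N) (m t : R).
Hypothesis coneD : forall c c', cone c -> cone c' -> cone (c + c').
Hypothesis coneZ : forall (s : R) c, 0 <= s -> cone c -> cone (s%:C *: c).
Hypothesis coneh : cone h.
Hypothesis lb : forall c, cone c -> m <= fnorm2 (c - Th).
Hypothesis t01 : 0 < t <= 1.
Hypothesis near_h : fnorm2 (h - Th) <= m + t ^+ 2.

(** First-order condition: compare the distance at [h] with that at [h + s c]. The near-minimizer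
    [h] stands in for a nearest point, which a cone not known to be closed might lack. *)
Lemma near_min_dual c (b : R) :
  cone c -> 0 <= b -> fnorm2 c <= b ^+ 2 -> - (t * b) <= rdot (h - Th) c.
Proof.
have /andP[t0 _] := t01; have nh := near_h.
move=> hc; rewrite le_eqVlt => /orP[/eqP<-|b0 hb].
  by rewrite expr0n => /fnorm2_eq0->; rewrite mulr0 oppr0 rdot0r.
(* This [s] keeps the quadratic term [s^2 |c|^2] within [t^2], the slack of [h]. *)
have [s s0 sb] : exists2 s : R, 0 < s & s * b = t.
  by exists (t / b); rewrite ?divr_gt0 // divfK // gt_eqF.
have := lb (coneD coneh (coneZ (ltW s0) hc)).
rewrite addrAC fnorm2D fnorm2Z rdotZr => hm.
have h2 : s ^+ 2 * fnorm2 c <= t ^+ 2.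
  by rewrite -sb exprMn; apply: ler_wpM2l => //; exact: sqr_ge0.
have h3 : 0 <= 2 * (t ^+ 2 + s * rdot (h - Th) c) by lra.
have : 0 <= s * (t * b + rdot (h - Th) c).
  by rewrite mulrDr mulrCA sb -expr2; lra.
by rewrite pmulr_rge0 //; lra.
Qed.

(** Compare [h] with [(1 - t) h], again in the cone; for an exact minimizer the inner product would
    be 0. *)
Lemma near_min_self : rdot (h - Th) h <= t * (1 + fnorm2 h) / 2.
Proof.
have /andP[t0 t1] := t01; have nh := near_h.
have s0 : 0 <= 1 - t by lra.
have := lb (coneZ s0 coneh).
have -> : (1 - t)%:C *: h - Th = (h - Th) + (- t)%:C *: h.
  by rewrite rmorphB rmorph1 scalerBl scale1r rmorphN scaleNr addrAC.
rewrite fnorm2D fnorm2Z rdotZr => hm.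
have : 0 <= t * (t * (1 + fnorm2 h) - 2 * rdot (h - Th) h) by nra.
by rewrite pmulr_rge0 //; lra.
Qed.

End NearMinimizer.

Lemma fnorm2_mul_adj_le n k (g : 'M[C]_(n, k)) (a : R) :
  fnorm2 g <= a -> fnorm2 (g *m adj g) <= a ^+ 2.
Proof.
move=> ha; apply: le_trans (fnorm2M_le _ _) _; rewrite fnorm2_adj expr2.
by apply: ler_pM => //; exact: fnorm2_ge0.
Qed.

Lemma rdot_mul_adj n k l (g : 'M[C]_(n, k)) (X : 'M[C]_(n, l)) :
  rdot (g *m adj g) (X *m adj X) = fnorm2 (adj g *m X).
Proof. by rewrite [LHS]rdotC rdot_mulr adjK fnorm2E [RHS]rdot_mull adjK mulmxA. Qed.

Lemma rdot_gram n k (S : 'M[C]_n) (X : 'M[C]_(n, k)) :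
  rdot (adj S *m S) (X *m adj X) = fnorm2 (S *m X).
Proof. by have := rdot_mul_adj (adj S) X; rewrite adjK. Qed.

Lemma rdot_gram1 n k (X : 'M[C]_(n, k)) : rdot 1%:M (X *m adj X) = fnorm2 X.
Proof. by have := rdot_gram 1%:M X; rewrite mulmx1 adj_mx1 mul1mx. Qed.

Variables (N p q k : nat) (f : {linear 'M[C]_(N, q) -> 'M[C]_(N, p)}).
Variables (u : 'cV[C]_N) (w : 'I_k -> 'cV[C]_N) (e : R).
Hypothesis hf : strict_contraction f.
Hypothesis key : forall S : 'M[C]_N, S \in unitmx ->
  strict_contraction (fun V => S *m f (invmx S *m V)) ->
  e ^+ 2 * fnorm2 (S *m u) <= \sum_j fnorm2 (S *m w j).

Definition cone_elt (gs : seq 'M[C]_(N, q)) (vs : seq 'cV[C]_N) : 'M[C]_N :=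
  \sum_(g <- gs) (g *m adj g - f g *m adj (f g)) + \sum_(v <- vs) v *m adj v.

Definition target : 'M[C]_N :=
  \sum_j w j *m adj (w j) - (e ^+ 2)%:C *: (u *m adj u).

Let cone c := exists gs vs, c = cone_elt gs vs.

Let coneD c c' : cone c -> cone c' -> cone (c + c').
Proof.
move=> [gs [vs ->]] [gs' [vs' ->]]; exists (gs ++ gs'), (vs ++ vs').
by rewrite /cone_elt !big_cat addrACA.
Qed.

Lemma scale_mul_adj n l (s : R) (g : 'M[C]_(n, l)) : 0 <= s ->
  ((Num.sqrt s)%:C *: g) *m adj ((Num.sqrt s)%:C *: g) = s%:C *: (g *m adj g).
Proof.
by move=> s0; rewrite adj_scale -scalemxAl -scalemxAr scalerA -rmorphM -expr2 sqr_sqrtr.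
Qed.

Let coneZ (s : R) c : 0 <= s -> cone c -> cone (s%:C *: c).
Proof.
move=> s0 [gs [vs ->]].
exists [seq (Num.sqrt s)%:C *: g | g <- gs], [seq (Num.sqrt s)%:C *: v | v <- vs].
rewrite /cone_elt scalerDr !scaler_sumr !big_map.
congr (_ + _); apply: eq_bigr => g _; last by rewrite scale_mul_adj.
by rewrite linearZ /= !scale_mul_adj // scalerBr.
Qed.

Lemma selfadj_cone_elt gs vs : selfadj (cone_elt gs vs).
Proof.
apply: selfadjD; apply: selfadj_sum => g; last exact: selfadj_mul_adj.
by apply: selfadjB; exact: selfadj_mul_adj.
Qed.

Lemma selfadj_target : selfadj target.
Proof.
apply: selfadjB; first by apply: selfadj_sum => j; exact: selfadj_mul_adj.
by apply: selfadjZ; exact: selfadj_mul_adj.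
Qed.

(* The perturbation [s%:C *: 1%:M] makes the approximate dual element [P]
   strictly positive; it then defines a new inner product on [C^N] in which [f]
   is a strict contraction, and [key] applies. *)
Lemma dual_pos (P : 'M[C]_N) (r t s : R) : selfadj P -> 0 < t ->
  0 <= r < 1 -> (forall V, fnorm2 (f V) <= r * fnorm2 V) -> 3 <= s * (1 - r) ->
  (forall c b, cone c -> 0 <= b -> fnorm2 c <= b ^+ 2 -> - (t * b) <= rdot P c) ->
  0 <= rdot (P + (t * s)%:C *: 1%:M) target.
Proof.
move=> hP t0 /andP[r0 r1] hr hs dualP.
set P' := P + _.
have s3 : 3 <= s by nra.
have P'E X : rdot P' X = rdot P X + t * s * rdot 1%:M X by rewrite rdotDl rdotZl.
have posv (v : 'cV[C]_N) : t * fnorm2 v <= rdot P' (v *m adj v).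
  have cv : cone (v *m adj v).
    by exists [::], [:: v]; rewrite /cone_elt big_nil big_seq1 add0r.
  have := dualP _ _ cv (fnorm2_ge0 v) (fnorm2_mul_adj_le (lexx _)).
  rewrite P'E rdot_gram1; have : 0 <= t * fnorm2 v by rewrite mulr_ge0 ?fnorm2_ge0 ?ltW.
  by set y := fnorm2 v; nra.
(* Origin of the constant 3: the cone element has norm at most [2 |g|^2], so the dual bound costs at
   most [2 t |g|^2], while the perturbation gains [t s (1 - r) |g|^2], at least [3 t |g|^2]. *)
have posg (g : 'M[C]_(N, q)) :
    t * fnorm2 g <= rdot P' (g *m adj g) - rdot P' (f g *m adj (f g)).
  have cg : cone (g *m adj g - f g *m adj (f g)).
    by exists [:: g], [::]; rewrite /cone_elt big_nil big_seq1 addr0.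
  have g0 := fnorm2_ge0 g.
  have fg : fnorm2 (f g) <= fnorm2 g by apply: le_trans (hr g) _; nra.
  have cb : fnorm2 (g *m adj g - f g *m adj (f g)) <= (2 * fnorm2 g) ^+ 2.
    rewrite fnorm2D rdotNr fnorm2N.
    have h1 := fnorm2_mul_adj_le (lexx (fnorm2 g)); have h2 := fnorm2_mul_adj_le fg.
    have := rdot_le_of_fnorm2 g0 g0 h1 h2; rewrite ler_norml => /andP[h3 _].
    by move: h1 h2 h3; rewrite exprMn !expr2; lra.
  have := dualP _ _ cg (mulr_ge0 (ler0n _ 2) g0) cb.
  rewrite -rdotBr P'E => h.
  have h1 : (1 - r) * fnorm2 g <= rdot 1%:M (g *m adj g - f g *m adj (f g)).
    by rewrite rdotBr !rdot_gram1; have := hr g; lra.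
  have h2 : t * s * ((1 - r) * fnorm2 g) <=
      t * s * rdot 1%:M (g *m adj g - f g *m adj (f g)).
    by apply: ler_wpM2l => //; apply: mulr_ge0; lra.
  have h3 : t * (3 * fnorm2 g) <= t * s * ((1 - r) * fnorm2 g).
    rewrite -[X in _ <= X]mulrA; apply: ler_wpM2l; first exact: ltW.
    by rewrite mulrA; apply: ler_wpM2r.
  by lra.
have [] := @posdef_factor R N P' t _ t0 posv.
  by apply: selfadjD => //; apply: selfadjZ; rewrite /selfadj adj_mx1.
move=> S uS SP.
have := key uS; rewrite /target rdotBr rdot_sumr rdotZr -SP rdot_gram subr_ge0.
under [X in _ -> _ <= X]eq_bigr do rewrite rdot_gram.
apply; rewrite -SP in posg.
(* As [|V|^2 <= K |S^-1 V|^2], the gain [t |S^-1 V|^2] from [posg] is at least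
   [t / (K + t) * |V|^2]; adding [t] keeps the denominator positive and the ratio at most 1. *)
pose K := fnorm2 S; have K0 : 0 <= K := fnorm2_ge0 _.
have Kt : 0 < K + t by lra.
have rho : 0 < t / (K + t) <= 1.
  by rewrite divr_gt0 //= ler_pdivrMr // mul1r; lra.
exists (1 - t / (K + t)) => [|V].
  by move: rho => /andP[? ?]; apply/andP; split; lra.
have := posg (invmx S *m V); rewrite !rdot_gram mulKVmx //.
have hV : fnorm2 V <= K * fnorm2 (invmx S *m V).
  by rewrite -{1}[V](mulKVmx uS); exact: fnorm2M_le.
set g := fnorm2 (invmx S *m V) in hV *; have g0 : 0 <= g := fnorm2_ge0 _.
suff : t / (K + t) * fnorm2 V <= t * g by lra.
by rewrite mulrAC ler_pdivrMr // -mulrA ler_pM2l //; nra.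
Qed.

(** Otherwise the infimum [m] of the squared distances is positive. For a near-minimizer [h] and
    [P = h - target], [near_min_self] bounds [rdot P h] above and [dual_pos] bounds [rdot P target]
    below, with errors proportional to [t], so [fnorm2 P] falls below [m]. *)
Lemma cone_approx (eta : R) : 0 < eta ->
  exists gs vs, fnorm2 (cone_elt gs vs - target) <= eta.
Proof.
move=> eta0; apply: contrapT => hno.
pose D := [set fnorm2 (c - target) | c in cone]%classic.
have Dlb c : cone c -> eta <= fnorm2 (c - target).
  move=> [gs [vs ->]]; rewrite leNgt; apply/negP => /ltW hl; apply: hno.
  by exists gs, vs.
have cone0 : cone 0 by exists [::], [::]; rewrite /cone_elt !big_nil addr0.
have Dinf : has_inf D.
  split; first by exists (fnorm2 (0 - target)), 0.
  by exists eta => _ [c hc <-]; exact: Dlb.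
pose m := inf D.
have mlb c : cone c -> m <= fnorm2 (c - target).
  by move=> hc; apply: ge_inf; [exact: Dinf.2 | exists c].
have m0 : 0 < m.
  apply: lt_le_trans eta0 _; apply: lb_le_inf; first exact: Dinf.1.
  by move=> _ [c hc <-]; exact: Dlb.
have [r /andP[r0 r1] hr] := hf.
pose s := 3 / (1 - r).
have sE : s * (1 - r) = 3 by rewrite /s divfK // gt_eqF //; lra.
have s0 : 0 < s by rewrite divr_gt0 //; lra.
(* [t * B] bounds the sum of both errors, with [fnorm2 h] replaced by its bound
   [2 (m + 1) + 2 |target|^2]; the choice of [t] makes it at most [m / 2]. *)
pose B := (1 + (2 * (m + 1) + 2 * fnorm2 target)) / 2 + s * `|rdot 1%:M target|.
have B0 : 0 < B.
  rewrite /B; have := fnorm2_ge0 target; have : 0 <= s * `|rdot 1%:M target|.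
    by rewrite mulr_ge0 ?normr_ge0 // ltW.
  by lra.
pose t := Num.min 1 (m / (2 * B)).
have t0 : 0 < t by rewrite lt_min ltr01 divr_gt0 //; lra.
have t1 : t <= 1 by rewrite ge_min lexx.
have tB : t * B <= m / 2.
  apply: le_trans (_ : m / (2 * B) * B <= _).
    by apply: ler_wpM2r; [exact: ltW | rewrite ge_min lexx orbT].
  by rewrite invfM mulrA -[_ / B * B]mulrA mulVf ?mulr1 // gt_eqF.
have [_ [h hh <-] near] : exists2 y, D y & y < m + t ^+ 2.
  by apply: inf_adherent => //; rewrite exprn_gt0.
have t01 : 0 < t <= 1 by rewrite t0 t1.
have nearW := ltW near.
have dualP := near_min_dual coneD coneZ hh mlb t01 nearW.
have self := near_min_self coneZ hh mlb t01 nearW.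
have hP : selfadj (h - target).
  case: hh => gs [vs ->].
  by apply: selfadjB; [exact: selfadj_cone_elt | exact: selfadj_target].
have r01 : 0 <= r < 1 by rewrite r0 r1.
have sE' : 3 <= s * (1 - r) by rewrite sE.
have := dual_pos hP t0 r01 hr sE' dualP.
rewrite rdotDl rdotZl => pos.
have PE : fnorm2 (h - target) = rdot (h - target) h - rdot (h - target) target.
  by rewrite fnorm2E rdotBr.
have hb : fnorm2 h <= 2 * (m + 1) + 2 * fnorm2 target.
  have -> : h = (h - target) + target by rewrite subrK.
  (* The bound [|a + b|^2 <= 2 |a|^2 + 2 |b|^2] comes from [|a - b|^2 >= 0]. *)
  have := fnorm2_ge0 ((h - target) - target); rewrite (fnorm2D (_ - _)) rdotNr fnorm2N.
  rewrite fnorm2D; have : t ^+ 2 <= 1 by rewrite expr_le1 // ltW.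
  by lra.
have tr : t * s * rdot 1%:M target <= t * (s * `|rdot 1%:M target|).
  rewrite -mulrA; apply: ler_wpM2l; first exact: ltW.
  by apply: ler_wpM2l; [exact: ltW | exact: ler_norm].
have th : t * (1 + fnorm2 h) <= t * (1 + (2 * (m + 1) + 2 * fnorm2 target)).
  by apply: ler_wpM2l; [exact: ltW | lra].
have := mlb h hh.
have tBE : t * B = t * (1 + (2 * (m + 1) + 2 * fnorm2 target)) / 2
   + t * (s * `|rdot 1%:M target|) by rewrite /B mulrDr mulrA.
by lra.
Qed.

End ConeApproximation.

(** * Approximate interpolation at one point: Douglas factorization and the lurking isometry *)

Section LocalInterpolation.
Variable R : realType.
Local Notation C := R[i].

Lemma unitmx_mul_adj N a (U : 'M[C]_(N, a)) :
  (forall v : 'rV[C]_N, v *m U = 0 -> v = 0) -> U *m adj U \in unitmx.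
Proof.
move=> hU; rewrite -row_free_unit -kermx_eq0; apply/eqP/row_matrixP=> i.
rewrite row0; set v := row i _; apply: hU; apply: fnorm2_eq0.
have v0 : v *m (U *m adj U) = 0 by rewrite -row_mul mulmx_ker row0.
by rewrite fnorm2E rdot_mulr -mulmxA v0 rdot0r.
Qed.

Lemma douglas N a b (U : 'M[C]_(N, a)) (W : 'M[C]_(N, b)) :
  U *m adj U \in unitmx ->
  (forall n (X : 'M[C]_(N, n)), fnorm2 (adj W *m X) <= fnorm2 (adj U *m X)) ->
  exists2 V : 'M[C]_(a, b), right_contraction V & W = U *m V.
Proof.
move=> uU hWU; set Y := invmx (U *m adj U).
have Yadj : U *m adj U *m adj Y = 1%:M.
  by apply: mulmx1C; rewrite -[U *m adj U]selfadj_mul_adj -adjM mulmxV // adj_mx1.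
exists (adj U *m (Y *m W)); last by rewrite !mulmxA mulmxV // mul1mx.
move=> n Z; rewrite -fnorm2_adj !adjM adjK.
set X := adj Y *m (U *m adj Z).
have -> : adj W *m adj Y *m U *m adj Z = adj W *m X by rewrite /X !mulmxA.
apply: le_trans (hWU _ X) _.
(* [adj U *m X] is the orthogonal projection of [adj Z] on the range of [adj U], so its norm is at
   most that of [Z]. *)
have FE : fnorm2 (adj U *m X) = rdot (adj U *m X) (adj Z).
  by rewrite fnorm2E rdot_mull adjK [RHS]rdot_mull adjK /X !mulmxA Yadj mul1mx.
have [F0|F0] := lerP (fnorm2 (adj U *m X)) 0.
  exact: le_trans F0 (fnorm2_ge0 _).
rewrite -(ler_pM2l F0) -expr2 {1}FE -[X in _ <= _ * X]fnorm2_adj.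
exact: rdot_CS.
Qed.

Variables (d p q : nat) (delta : 'I_p -> 'I_q -> ncpoly R d).
Variables (k : nat) (psi : 'I_k -> ncfun R d) (eps : R).
Arguments psi : clear implicits.
Local Notation Dl x := (blockapp (fun i j => nceval (delta i j) x)).
Hypothesis hpsi : forall j, Hinf delta (psi j).
Hypothesis hcor : forall n (x : ncpoint R d n), Gdelta delta x ->
     geI (\sum_(j < k) adj (psi j n x) *m psi j n x) (eps ^+ 2).

Definition psi_col n (x : ncpoint R d n) (u : 'cV[C]_n) : 'M[C]_(n, k) :=
  \matrix_(a, j) (psi j n x *m u) a 0.

Lemma col_psi_col n (x : ncpoint R d n) u j : col j (psi_col x u) = psi j n x *m u.
Proof. by apply/colP=> a; rewrite !mxE. Qed.

(** The contraction hypothesis puts [x = S Lam S^-1] in [Gdelta]; the lower bound there, tested on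
    [S u], transfers back because each [psi j] respects similarity. *)
Lemma corona_similar N (Lam : ncpoint R d N) (u : 'cV[C]_N) (S : 'M[C]_N) :
  Gdelta delta Lam -> S \in unitmx ->
  strict_contraction (fun V => S *m Dl Lam (invmx S *m V)) ->
  eps ^+ 2 * fnorm2 (S *m u) <= \sum_j fnorm2 (S *m (psi j N Lam *m u)).
Proof.
move=> hLam uS [r r01 hr].
pose x := conj_pt (invmx S) Lam.
have xS i : x i *m S = S *m Lam i by rewrite /x /conj_pt invmxK mulmxKV.
have hx : Gdelta delta x.
  apply/bnorm_lt1P; exists r => // V.
  by rewrite -{1}[V](mulKVmx uS) (delta_intertwine _ _ xS).
apply: le_trans (hcor hx (S *m u)) _; rewrite le_eqVlt; apply/orP; left; apply/eqP.
rewrite mulmx_sumr mulmx_suml summxE Re_sum; apply: eq_bigr => j _.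
have [_ conj _] := hpsi j.
have -> : S *m (psi j N Lam *m u) = psi j N x *m (S *m u).
  by rewrite conj ?unitmx_inv // invmxK -!mulmxA mulKmx.
by rewrite fnorm2E /rdot /mxtrace big_ord1 !adjM !mulmxA.
Qed.

(** The cone element near the target gives [eps^2 u u^* + G G^* <= Psi Psi^* + eta' I + delta(G)
    delta(G)^*], that is [W W^* <= U U^*]; the factor [V] in [W = U V] is the colligation. *)
Lemma local_interpolation N (Lam : ncpoint R d N) (u : 'cV[C]_N) (eta : R) :
  Gdelta delta Lam -> 0 < eta ->
  exists2 T : ncrow R d k, schur_row delta T &
    fnorm2 (T N Lam (psi_col Lam u) - eps%:C *: u) <= eta.
Proof.
move=> hLam eta0.
pose nu := fnorm2 (1%:M : 'M[C]_N); have nu0 : 0 <= nu := fnorm2_ge0 _.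
(* Then [fnorm2 J = eta' * nu <= eta], the cost of dropping [J] at the end. *)
pose eta' := eta / (1 + nu).
have eta'0 : 0 < eta' by rewrite divr_gt0 //; lra.
have hf : strict_contraction (Dl Lam) by apply/bnorm_lt1P.
have key S := @corona_similar N Lam u S hLam.
have [gs [vs hgs]] := cone_approx hf key (exprn_gt0 2 eta'0).
set h := cone_elt _ _ _ in hgs; set Th := target _ _ _ in hgs.
pose G := row_of_seq gs; pose Psi := psi_col Lam u.
(* An auxiliary input block: it absorbs the error of the cone approximation and makes [U *m adj U]
   invertible. *)
pose J := (Num.sqrt eta')%:C *: (1%:M : 'M[C]_N).
pose U := row_mx (row_mx Psi J) (ampl (Dl Lam) G).
pose W : 'M[C]_(N, 1 + size gs * q) := row_mx (eps%:C *: u) G.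
have uU : U *m adj U \in unitmx.
  apply: unitmx_mul_adj => v; rewrite /U !mul_mx_row -[RHS]row_mx0.
  move/eq_row_mx => [+ _]; rewrite -[RHS]row_mx0 => /eq_row_mx[_].
  rewrite -scalemxAr mulmx1 => /eqP; rewrite scaler_eq0 => /orP[|/eqP//].
  by rewrite (inj_eq (@complexI R) _ 0) sqrtr_eq0 leNgt eta'0.
have hWU n (X : 'M[C]_(N, n)) : fnorm2 (adj W *m X) <= fnorm2 (adj U *m X).
  rewrite /U /W !adj_row_mx !mul_col_mx !fnorm2_col_mx row_of_seq_adj.
  rewrite ampl_row_of_seq_adj !adj_scale -!scalemxAl !fnorm2Z adj_mx1 mul1mx.
  rewrite sqr_sqrtr; last exact: ltW.
  have -> : fnorm2 (adj Psi *m X) = \sum_j fnorm2 (adj (psi j N Lam *m u) *m X).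
    rewrite fnorm2_rows; apply: eq_bigr => j _; rewrite row_mul -col_psi_col.
    by congr (fnorm2 (_ *m _)); apply/rowP=> a; rewrite !mxE.
  have := rdot_le_of_fnorm2 (ltW eta'0) (fnorm2_ge0 X) hgs (fnorm2_mul_adj_le (lexx _)).
  rewrite ler_norml => /andP[_].
  rewrite rdotBl /h /Th /cone_elt /target rdotDl rdotBl !rdot_suml rdotZl rdot_mul_adj.
  under eq_bigr do rewrite rdotBl !rdot_mul_adj.
  under [X in _ - (X - _)]eq_bigr do rewrite rdot_mul_adj.
  rewrite sumrB.
  have : 0 <= \sum_(v <- vs) rdot (v *m adj v) (X *m adj X).
    by apply: sumr_ge0 => v _; rewrite rdot_mul_adj fnorm2_ge0.
  by lra.
have [V hV WE] := douglas uU hWU.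
have [T0 [lin0 bd0 int0] T0E] := transfer delta hV.
have T0Psi : T0 N Lam (row_mx Psi J) = eps%:C *: u.
  (* Unfolded, [WE] is the [system] with input [row_mx Psi J], output [eps u] and state [G]. *)
  exact: T0E hLam WE.
exists (fun n x Z => T0 n x (row_mx Z 0)).
  split.
  - move=> n x a Z Z' hx; rewrite -lin0 //.
    by rewrite scale_row_mx add_row_mx scaler0 addr0.
  - move=> n x Z hx; apply: le_trans (bd0 _ _ _ hx) _.
    by rewrite fnorm2_row_mx fnorm20 addr0.
  - move=> m n y x S Z hy hx hS; rewrite -(int0 _ _ _ _ _ _ hy hx hS).
    by rewrite mul_mx_row mulmx0.
(* By linearity the error is, up to sign, the response to the input [J] alone. *)
have := lin0 N Lam 1 (row_mx Psi 0) (row_mx 0 J) hLam.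
rewrite !scale1r add_row_mx addr0 add0r T0Psi => ->; rewrite opprD addNKr fnorm2N.
apply: le_trans (bd0 _ _ _ hLam) _.
rewrite fnorm2_row_mx fnorm20 add0r /J fnorm2Z sqr_sqrtr; last exact: ltW.
by rewrite -/nu /eta' mulrAC ler_pdivrMr; nra.
Qed.

End LocalInterpolation.

(** * Limits of bounded matrix families along an ultrafilter *)

Section UltraLimit.
Variables (R : realType) (T : Type) (U : set_system T).
Hypothesis UU : UltraFilter U.
Local Notation C := R[i].
Local Open Scope classical_set_scope.

Let UP : ProperFilter U.
Proof. exact: ultra_proper. Qed.

(** A bounded family clusters in a compact segment, and a cluster point of an ultrafilter is its
    limit. *)
Lemma ultra_bounded_cvg (f : T -> R) (M : R) :
  U [set t | `|f t| <= M] -> exists l : R, f @ U --> l.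
Proof.
move=> hM; have hseg : U (f @^-1` `[- M, M]).
  by apply: filterS hM => t /= h; rewrite in_itv /= -ler_norml.
have [l [_ hl]] := @segment_compact R (- M) M (f @ U) _ hseg.
exists l => A hA; have [//|nA] := in_ultra_setVsetC (f @^-1` A) UU.
by have [y []] := hl (~` A) A nA hA.
Qed.

(** Real and imaginary parts converge separately, so only the topology of [R] enters. *)
Definition clim (f : T -> C) (z : C) :=
  ((fun t => complex.Re (f t)) @ U --> complex.Re z) /\
  ((fun t => complex.Im (f t)) @ U --> complex.Im z).

Lemma clim_cst (z : C) : clim (fun _ => z) z.
Proof. by split; exact: cvg_cst. Qed.

Lemma clim_lin (a : C) f g y z : clim f y -> clim g z ->
  clim (fun t => a * f t + g t) (a * y + z).
Proof.
have ReE (u v : C) : complex.Re (a * u + v) =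
    complex.Re a * complex.Re u - complex.Im a * complex.Im u + complex.Re v.
  by case: a u v => ? ? [? ?] [? ?].
have ImE (u v : C) : complex.Im (a * u + v) =
    complex.Re a * complex.Im u + complex.Im a * complex.Re u + complex.Im v.
  by clear ReE; case: a u v => ? ? [? ?] [? ?].
move=> [fr fi] [gr gi]; split.
  rewrite ReE; under eq_fun do rewrite ReE.
  by apply: cvgD gr; apply: cvgB; apply: cvgM => //; exact: cvg_cst.
rewrite ImE; under eq_fun do rewrite ImE.
by apply: cvgD gi; apply: cvgD; apply: cvgM => //; exact: cvg_cst.
Qed.

Lemma clim_unique f g y z : clim f y -> clim g z -> U [set t | f t = g t] -> y = z.
Proof.
move=> [fr fi] [gr gi] fg; case: y z fr fi gr gi => a b [a' b'] /= fr fi gr gi.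
have ea : a = a'.
  apply: (cvg_unique (@Rhausdorff R) _ gr); apply: cvg_trans fr.
  by apply: near_eq_cvg; apply: filterS fg => t /= ->.
have eb : b = b'.
  apply: (cvg_unique (@Rhausdorff R) _ gi); apply: cvg_trans fi.
  by apply: near_eq_cvg; apply: filterS fg => t /= ->.
by rewrite ea eb.
Qed.

Lemma cvg_sumr I (r : seq I) (f : I -> T -> R) (l : I -> R) :
  (forall i, f i @ U --> l i) ->
  (fun t => \sum_(i <- r) f i t) @ U --> \sum_(i <- r) l i.
Proof.
move=> h; elim: r => [|i r IH].
  by rewrite big_nil; under eq_fun do rewrite big_nil; exact: cvg_cst.
rewrite big_cons; under eq_fun do rewrite big_cons.
by apply: cvgD.
Qed.

Definition mclim m n (F : T -> 'M[C]_(m, n)) (A : 'M[C]_(m, n)) :=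
  forall i j, clim (fun t => F t i j) (A i j).

Lemma mclim_cst m n (A : 'M[C]_(m, n)) : mclim (fun _ => A) A.
Proof. by move=> i j; exact: clim_cst. Qed.

Lemma mclim_lin m n (a : C) (F G : T -> 'M[C]_(m, n)) A B :
  mclim F A -> mclim G B -> mclim (fun t => a *: F t + G t) (a *: A + B).
Proof.
move=> hF hG i j; rewrite !mxE; under eq_fun do rewrite !mxE.
exact: clim_lin.
Qed.

Lemma mclim_mul m n k (S : 'M[C]_(k, m)) (F : T -> 'M[C]_(m, n)) A :
  mclim F A -> mclim (fun t => S *m F t) (S *m A).
Proof.
move=> hF i j; rewrite !mxE; under eq_fun do rewrite !mxE.
elim: (index_enum _) => [|b r IH].
  by rewrite big_nil; under eq_fun do rewrite big_nil; exact: clim_cst.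
rewrite big_cons; under eq_fun do rewrite big_cons.
exact: clim_lin.
Qed.

Lemma mclim_unique m n (F G : T -> 'M[C]_(m, n)) A B :
  mclim F A -> mclim G B -> U [set t | F t = G t] -> A = B.
Proof.
move=> hF hG FG; apply/matrixP=> i j; apply: clim_unique (hF i j) (hG i j) _.
by apply: filterS FG => t /= ->.
Qed.

Lemma mclim_fnorm2_le m n (F : T -> 'M[C]_(m, n)) A (c : R) :
  mclim F A -> U [set t | fnorm2 (F t) <= c] -> fnorm2 A <= c.
Proof.
move=> hF hc.
suff cv : (fun t => fnorm2 (F t)) @ U --> fnorm2 A by exact: cvgr_to_le cv hc.
apply: cvg_sumr => i; apply: cvg_sumr => j; have [hr hi] := hF i j.
by apply: cvgD; rewrite ?expr2; under eq_fun do rewrite expr2; apply: cvgM.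
Qed.

Lemma mclim_exists m n (F : T -> 'M[C]_(m, n)) (c : R) :
  U [set t | fnorm2 (F t) <= c] -> exists A, mclim F A.
Proof.
move=> hc.
(* A crude bound, since [x^2 <= r] gives [|x| <= 1 + r]; it avoids square roots. *)
have abs2_bound (z : C) (r : R) : abs2 z <= r ->
    `|complex.Re z| <= 1 + r /\ `|complex.Im z| <= 1 + r.
  case: z => a b; rewrite /abs2 /= => h.
  have := sqr_ge0 a; have := sqr_ge0 b => b0 a0.
  have sq (x : R) : x ^+ 2 <= r -> `|x| <= 1 + r.
    by rewrite -real_normK ?num_real //; have := normr_ge0 x; nra.
  by split; apply: sq; lra.
have ex i j : exists z, clim (fun t => F t i j) z.
  have hb : U [set t | abs2 (F t i j) <= c].
    by apply: filterS hc => t /=; apply: le_trans; exact: abs2_le_fnorm2.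
  have [|a ha] := @ultra_bounded_cvg (fun t => complex.Re (F t i j)) (1 + c).
    by apply: filterS hb => t /abs2_bound[].
  have [|b hb'] := @ultra_bounded_cvg (fun t => complex.Im (F t i j)) (1 + c).
    by apply: filterS hb => t /abs2_bound[].
  by exists (a +i* b).
exists (\matrix_(i, j) sval (cid (ex i j))) => i j.
by rewrite mxE; exact: (svalP (cid (ex i j))).
Qed.

End UltraLimit.

(** * Linear maps from [k]-tuples of vectors to vectors, as rows of square matrices *)

Section MatrixOfRow.
Variables (R : realType) (n k : nat).
Local Notation C := R[i].
Variable F : {linear 'M[C]_(n, k) -> 'cV[C]_n}.

Definition row_mx_of (j : 'I_k) : 'M[C]_n := \matrix_(a, b) F (delta_mx b j) a 0.

Lemma row_mx_ofE j (v : 'cV[C]_n) : row_mx_of j *m v = F (v *m delta_mx 0 j).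
Proof.
rewrite [v in RHS]matrix_sum_delta mulmx_suml linear_sum; apply/colP=> a.
rewrite !mxE summxE; apply: eq_bigr => b _.
rewrite big_ord1 -scalemxAl mul_delta_mx linearZ /= !mxE.
by rewrite mulrC.
Qed.

Lemma row_mx_of_sum (Z : 'M[C]_(n, k)) : \sum_j row_mx_of j *m col j Z = F Z.
Proof.
transitivity (\sum_j F (col j Z *m delta_mx 0 j)).
  by apply: eq_bigr => j _; exact: row_mx_ofE.
rewrite -linear_sum; congr (F _); apply/matrixP=> a b.
rewrite summxE (bigD1 b) //= big1 => [|j jb].
  by rewrite !mxE big_ord1 !mxE !eqxx mulr1 addr0.
by rewrite !mxE big_ord1 !mxE [b == j]eq_sym (negPf jb) andbF mulr0.
Qed.

End MatrixOfRow.

(** * Passage from one point to all of [Gdelta] *)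

Section Corona.
Variables (R : realType) (d p q : nat) (delta : 'I_p -> 'I_q -> ncpoly R d).
Local Notation C := R[i].
Variables (k : nat) (psi : 'I_k -> ncfun R d) (eps : R).
Arguments psi : clear implicits.
Hypothesis hpsi : forall j, Hinf delta (psi j).
Hypothesis hcor : forall n (x : ncpoint R d n), Gdelta delta x ->
     geI (\sum_(j < k) adj (psi j n x) *m psi j n x) (eps ^+ 2).

Lemma psi_col_dsum m n (x : ncpoint R d m) (y : ncpoint R d n) u v :
  Gdelta delta x -> Gdelta delta y ->
  psi_col psi (dsum_pt x y) (col_mx u v) = col_mx (psi_col psi x u) (psi_col psi y v).
Proof.
move=> hx hy; apply: matrix_eq_cols => j; rewrite col_psi_col.
have [ds _ _] := hpsi j.
by rewrite ds // mul_block_col !mul0mx addr0 add0r col_col_mx !col_psi_col.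
Qed.

Lemma schur_row_dsum K (T : ncrow R d K) m n (x : ncpoint R d m) (y : ncpoint R d n) Z W :
  schur_row delta T -> Gdelta delta x -> Gdelta delta y ->
  T _ (dsum_pt x y) (col_mx Z W) = col_mx (T _ x Z) (T _ y W).
Proof.
move=> [lin _ int] hx hy; have hxy := Gdelta_dsum hx hy.
have -> : col_mx Z W = 1 *: (col_mx 1%:M 0 *m Z) + col_mx 0 1%:M *m W.
  by rewrite scale1r mul_inl_mx mul_inr_mx add_col_mx addr0 add0r.
rewrite lin // (int _ _ _ _ _ _ hxy hx (dsum_pt_inl x y)).
rewrite (int _ _ _ _ _ _ hxy hy (dsum_pt_inr x y)) scale1r.
by rewrite mul_inl_mx mul_inr_mx add_col_mx addr0 add0r.
Qed.

(** Each condition [B i] prescribes one value up to a tolerance; along an ultrafilter containing all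
    of them, the limiting row interpolates exactly. *)
Lemma global_interpolation : exists2 T : ncrow R d k, schur_row delta T &
  forall n (x : ncpoint R d n) u, Gdelta delta x ->
    T n x (psi_col psi x u) = eps%:C *: u.
Proof.
pose I := {N : nat & (ncpoint R d N * 'cV[C]_N * R)%type}.
pose D : set I := fun i => let: existT N (x, _, eta) := i in
  Gdelta delta x /\ 0 < eta.
pose B (i : I) : set (ncrow R d k) := let: existT N (x, u, eta) := i in
  fun T => schur_row delta T /\
    fnorm2 (T N x (psi_col psi x u) - eps%:C *: u) <= eta.
have BD i : D i -> (B i !=set0)%classic.
  case: i => N [[x u] eta] [hx eta0].
  by have [T hT hTu] := local_interpolation hpsi hcor u hx eta0; exists T.
have D0 : exists i, D i.
  (* The point of size 0 makes the index set nonempty, since matrices without rows have norm 0. *)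
  exists (existT _ 0%N (fun _ => 0, 0, 1)); split=> //.
  apply/bnorm_lt1P; exists 0; first by rewrite lexx ltr01.
  by move=> V; rewrite mul0r [blockapp _ _]flatmx0 fnorm20.
have FF : ProperFilter (filter_from D B).
  apply: filter_from_proper BD; apply: filter_from_filter => //.
  move=> [N [[x u] eta]] [M [[y v] eta']] [hx e0] [hy e0'].
  (* Approximate interpolation at the direct sum gives it at both summands, so the sets [B i] form a
     filter base. *)
  exists (existT _ (N + M)%N (dsum_pt x y, col_mx u v, Num.min eta eta')).
    by split; [exact: Gdelta_dsum | rewrite lt_min e0].
  move=> T [hT]; rewrite psi_col_dsum // schur_row_dsum // scale_col_mx.
  rewrite opp_col_mx add_col_mx fnorm2_col_mx le_min => /andP[h h'].
  split; split=> //; [apply: le_trans h | apply: le_trans h'].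
    by rewrite lerDl fnorm2_ge0.
  by rewrite lerDr fnorm2_ge0.
have [U [UU sU]] := ultraFilterLemma FF.
have UP : ProperFilter U by exact: ultra_proper.
have Usch : U (@schur_row R d p q delta k).
  have [i Di] := D0; apply: sU; exists i => //.
  by case: i Di => N [[x u] eta] _ T [].
have ex n (x : ncpoint R d n) Z : exists w, Gdelta delta x ->
    mclim U (fun T : ncrow R d k => T n x Z) w.
  have [hx|nhx] := pselect (Gdelta delta x); last by exists 0.
  have [|A hA] := @mclim_exists R _ U UU _ _ (fun T : ncrow R d k => T n x Z) (fnorm2 Z).
    by apply: filterS Usch => T [_ bd _]; exact: bd.
  by exists A.
pose T : ncrow R d k := fun n x Z => sval (cid (ex n x Z)).
have TP n (x : ncpoint R d n) Z : Gdelta delta x ->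
    mclim U (fun T : ncrow R d k => T n x Z) (T n x Z).
  exact: (svalP (cid (ex n x Z))).
exists T; first split.
- move=> n x a Z Z' hx.
  apply: (mclim_unique UU (TP _ _ _ hx) (mclim_lin UU a (TP _ _ _ hx) (TP _ _ _ hx))).
  by apply: filterS Usch => S [lin _ _]; exact: lin.
- move=> n x Z hx; apply: (mclim_fnorm2_le UU (TP _ _ _ hx)).
  by apply: filterS Usch => S [_ bd _]; exact: bd.
- move=> m n y x S Z hy hx hS.
  apply: (mclim_unique UU (TP _ _ _ hy) (mclim_mul UU S (TP _ _ _ hx))).
  by apply: filterS Usch => F [_ _ int]; exact: int.
move=> n x u hx; apply/eqP; rewrite -subr_eq0; apply/eqP/fnorm2_eq0.
(* The error of the limit is at most every [eta > 0], since the condition with that tolerance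
   belongs to [U]. *)
apply/ler_addgt0Pl => eta eta0; rewrite addr0.
have := mclim_lin UU 1 (TP n x (psi_col psi x u) hx) (mclim_cst UU (- (eps%:C *: u))).
rewrite scale1r => /(mclim_fnorm2_le UU); apply.
apply: sU; exists (existT _ n (x, u, eta)) => //= S [_] /=.
by rewrite scale1r.
Qed.

End Corona.

Theorem theorem8p16 (R : realType) (d p q : nat)
    (delta : 'I_p -> 'I_q -> ncpoly R d) (k : nat) (psi : 'I_k -> ncfun R d)
    (eps : R) :
  (forall j, Hinf delta (psi j)) ->
  0 < eps ->
  (forall n (x : ncpoint R d n), Gdelta delta x ->
     geI (\sum_(j < k) adj (psi j n x) *m psi j n x) (eps ^+ 2)) ->
  exists omega : 'I_k -> ncfun R d,
    [/\ forall j, Hinf delta (omega j),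
        (forall n (x : ncpoint R d n), Gdelta delta x ->
           bnorm (fun (_ : 'I_1) j => omega j n x) <= eps^-1) &
        (forall n (x : ncpoint R d n), Gdelta delta x ->
           \sum_(j < k) omega j n x *m psi j n x = 1%:M)].
Proof.
move=> hpsi eps0 hcor.
have [T [lin bd int] Tpsi] := global_interpolation hpsi hcor.
have e0 : 0 <= eps^-1 by rewrite invr_ge0 ltW.
(* The [j]-th block of [T n x], as in [row_mx_of], divided by [eps]; it is written out because
   linearity of [T n x] is known only on [Gdelta]. *)
pose om (j : 'I_k) n (x : ncpoint R d n) : 'M[R[i]]_n :=
  (eps^-1)%:C *: \matrix_(a, b) T n x (delta_mx b j) a 0.
have linT n (x : ncpoint R d n) : Gdelta delta x ->
    exists F : {linear 'M[R[i]]_(n, k) -> 'cV[R[i]]_n}, T n x = F :> (_ -> _).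
  move=> hx; have l : linear (T n x) by move=> a Z Z'; exact: lin.
  by exists (HB.pack_for {linear 'M[R[i]]_(n, k) -> 'cV[R[i]]_n} (T n x)
    (GRing.isLinear.Build R[i] _ _ _ (T n x) l)).
have omE j n (x : ncpoint R d n) v : Gdelta delta x ->
    om j n x *m v = (eps^-1)%:C *: T n x (v *m delta_mx 0 j).
  move=> hx; have [F FE] := linT n x hx; rewrite /om -scalemxAl FE.
  by rewrite -(row_mx_ofE F).
have om_sum n (x : ncpoint R d n) Z : Gdelta delta x ->
    \sum_j om j n x *m col j Z = (eps^-1)%:C *: T n x Z.
  move=> hx; have [F FE] := linT n x hx; rewrite FE -(row_mx_of_sum F) scaler_sumr.
  by apply: eq_bigr => j _; rewrite /om FE -scalemxAl.
have om_int j m n (y : ncpoint R d m) (x : ncpoint R d n) (S : 'M[R[i]]_(m, n)) :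
    Gdelta delta y -> Gdelta delta x -> (forall i, y i *m S = S *m x i) ->
    om j m y *m S = S *m om j n x.
  move=> hy hx hS; apply: matrix_eq_cols => b; rewrite !colE -!mulmxA !omE // -mulmxA.
  by rewrite (int _ _ _ _ _ _ hy hx hS) scalemxAr.
exists om; split.
- move=> j; split.
  + move=> n m x y hx hy; have hxy := Gdelta_dsum hx hy.
    (* The identity splits into the two inclusions, and each is moved across [om j] by
       intertwining. *)
    rewrite -[LHS]mulmx1 scalar_mx_block block_mxEh mul_mx_row.
    rewrite (om_int _ _ _ _ _ _ hxy hx (dsum_pt_inl x y)).
    rewrite (om_int _ _ _ _ _ _ hxy hy (dsum_pt_inr x y)).
    by rewrite mul_inl_mx mul_inr_mx -block_mxEh.
  + move=> n x s us hx hsx.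
    (* Similarity is intertwining by [s] between [conj_pt s x] and [x]. *)
    rewrite -mulmxA (om_int _ _ _ _ (conj_pt s x)) ?mulKmx // => i.
    by rewrite /conj_pt !mulmxA mulmxV // mul1mx.
  + exists eps^-1 => n x hx; apply: bnorm_le => // V.
    have -> : blockapp (fun _ _ : 'I_1 => om j n x) V = om j n x *m V.
      apply: matrix_eq_cols => i; rewrite col_blockapp big_ord1 !colE mulmxA.
      by rewrite (ord1 i).
    (* [V] is placed in slot [j] of a [k]-tuple, which does not increase its norm. *)
    rewrite omE // fnorm2Z; apply: ler_wpM2l; first exact: sqr_ge0.
    apply: le_trans (bd _ _ _ hx) _; apply: le_trans (fnorm2M_le _ _) _.
    by rewrite fnorm2_delta mulr1.
- move=> n x hx; apply: bnorm_le => // V.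
  have -> : blockapp (fun (_ : 'I_1) j => om j n x) V = (eps^-1)%:C *: T n x V.
    by apply: matrix_eq_cols => i; rewrite col_blockapp om_sum // (ord1 i);
      apply/colP=> a; rewrite !mxE.
  by rewrite fnorm2Z; apply: ler_wpM2l; [exact: sqr_ge0 | exact: bd].
(* On a basis vector [u] the sum is [eps^-1 T(psi(x) u) = eps^-1 eps u = u]. *)
- move=> n x hx; apply: matrix_eq_cols => b; rewrite [in RHS]colE mul1mx.
  set u := delta_mx b 0; rewrite colE mulmx_suml.
  transitivity (\sum_j om j n x *m col j (psi_col psi x u)).
    by apply: eq_bigr => j _; rewrite col_psi_col mulmxA.
  by rewrite om_sum // Tpsi // scalerA -rmorphM mulVf ?gt_eqF // scale1r.
Qed.
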